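(* Let $V$ be a vector space over $\mathbb{K} \in \{\mathbb{R}, \mathbb{C}\}$, and let $\mathcal{S}$ be a collection of functions $\sigma : V \to \mathbb{R}_{\geq 0}$ such that each $\sigma \in \mathcal{S}$ is a $p$-homogeneous seminorm on $V$ for some $p \in (0,1]$, where $p$ may depend on $\sigma$. Let $\tau_{\mathcal{S}}$ be the topology on $V$ generated by the sub-base consisting of all sets $$\mathcal{U}_{x,\sigma,\epsilon} = \{ y \in V \mid \sigma(y - x) < \epsilon \}, \qquad x \in V,\ \sigma \in \mathcal{S},\ \epsilon > 0.$$ Then $(V, \tau_{\mathcal{S}})$ is a good topological vector space.
   Context: $\mathbb{N}$ denotes the set of positive integers. A topological vector space is a pair $(V,\tau)$ where $V$ is a vector space over $\mathbb{K} \in \{\mathbb{R},\mathbb{C}\}$ and $\tau$ is a topology on $V$ (not assumed to be Hausdorff) under which vector addition and scalar multiplication are continuous. For $p \in (0,1]$, a $p$-homogeneous seminorm on $V$ is a function $\sigma : V \to \mathbb{R}_{\geq 0}$ such that (1) $\sigma(x+y) \leq \sigma(x) + \sigma(y)$ for all $x,y \in V$, and (2) $\sigma(kx) = |k|^p \sigma(x)$ for all $k \in \mathbb{K}$ and $x \in V$. A point $x \in V$ is a $\tau$-limit of a sequence $(x_n)_{n \in \mathbb{N}}$ in $V$ if for each $\tau$-neighborhood $U$ of $x$ there is $n_0 \in \mathbb{N}$ such that $x_n \in U$ for all $n \geq n_0$ (limits need not be unique). A topological vector space $(V,\tau)$ is called good if and only if any sequence $(x_n)_{n \in \mathbb{N}}$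 in $V$ has a $\tau$-limit whenever the sequence $(2x_{n+1} - x_n)_{n \in \mathbb{N}}$ has a $\tau$-limit. *)

(* Defs.v *)
From HB Require Import structures.
From mathcomp Require Import all_boot all_order all_algebra.
From mathcomp Require Import all_classical reals topology normedtype sequences exp.
From mathcomp Require Import complex.
Set Implicit Arguments.
Unset Strict Implicit.
Unset Printing Implicit Defensive.
Import Order.TTheory GRing.Theory Num.Theory.
Local Open Scope classical_set_scope.
Local Open Scope ring_scope.

Inductive scalars := RealScalars | ComplexScalars.

Definition scalar_field (R : realType) (s : scalars) : numFieldType :=
  match s with
  | RealScalars => R
  | ComplexScalars => R[i]
  end.

(* The norm of [R[i]] takes its values in [R[i]] itself, on the real axis;
   [absval] is the modulus as an element of [R]. *)
Definition absval (R : realType) (s : scalars) : scalar_field R s -> R :=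
  match s return scalar_field R s -> R with
  | RealScalars => fun k => `|k|
  | ComplexScalars => fun k => complex.Re `|k|
  end.
Arguments absval {R s}.

Definition homogeneous_seminorm (R : realType) (s : scalars)
    (V : lmodType (scalar_field R s)) (p : R) (sigma : V -> R) : Prop :=
  [/\ forall x, 0 <= sigma x,
      forall x y, sigma (x + y) <= sigma x + sigma y
    & forall (k : scalar_field R s) x, sigma (k *: x) = absval k `^ p * sigma x].

Definition seminorm_subbase (R : realType) (K : numFieldType) (V : lmodType K)
    (S : set (V -> R)) : set_system V :=
  [set U | exists x sigma (eps : R),
     [/\ S sigma, 0 < eps & U = [set y | sigma (y - x) < eps]]].

(* A copy of [V] that carries the topology generated by the sub-base;
   for an empty [S] it is the indiscrete topology. *)
Definition seminorm_space (R : realType) (K : numFieldType) (V : lmodType K)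
  (S : set (V -> R)) : Type := V.

HB.instance Definition _ (R : realType) (K : numFieldType) (V : lmodType K)
  (S : set (V -> R)) := GRing.Lmodule.on (seminorm_space S).
HB.instance Definition _ (R : realType) (K : numFieldType) (V : lmodType K)
    (S : set (V -> R)) :=
  isSubBaseTopological.Build (seminorm_space S) (seminorm_subbase S) id.

(* The library's [topologicalLmodType] as a predicate on a vector space with a
   topology; its [tvsType] would moreover require local convexity. *)
Definition topological_vector_space (K : numFieldType)
    (E : preTopologicalLmodType K) : Prop :=
  continuous (fun z : E * E => z.1 + z.2) /\
  continuous (fun z : K^o * E => z.1 *: z.2).

(* Sequences are indexed from 0; limits need not be unique, so [lim] is not
   used. *)
Definition good (K : numFieldType) (E : preTopologicalLmodType K) : Prop :=
  forall u : nat -> E,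
    (exists l : E, (fun n => 2 *: u n.+1 - u n) @ \oo --> l) ->
    exists l : E, u @ \oo --> l.

(* Main.v *)
Require Import Defs.
From mathcomp Require Import all_boot all_order all_algebra.
From mathcomp Require Import all_classical reals topology normedtype sequences exp.
From mathcomp Require Import complex.
From mathcomp Require Import lra.
Import Order.TTheory GRing.Theory Num.Theory.
Local Open Scope classical_set_scope.
Local Open Scope ring_scope.

(** A filter on the space converges to l exactly when sigma (y - l) becomes
    small for each seminorm sigma of the family separately
    ([cvg_seminorm_space]), so everything reduces to estimates for one
    p-homogeneous seminorm at a time.

    Addition is continuous by the triangle inequality. Scalar multiplication is
    continuous because k x - k0 x0 splits into
    k0 (x - x0) + (k - k0) (x - x0) + (k - k0) x0, and each of the three terms
    has small seminorm when k is near k0 and x is near x0.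

    For goodness, suppose that v_n = 2 u_{n+1} - u_n tends to l. Then l is also
    a limit of u: from 2 (u_{n+1} - l) = (u_n - l) + (v_n - l) one gets, with
    a_n = sigma (u_n - l) and b_n = sigma (v_n - l),
      a_{n+1} <= 2^-p (a_n + b_n),
    and 2^-p < 1 because p > 0. Such a contracting recurrence with a vanishing
    perturbation forces a_n to tend to 0 ([contracting_recurrence_cvg0]). The
    limit l does not depend on sigma, so it serves the whole family even though
    the exponent p varies with sigma. *)

(** Once b_n <= d, the map t |-> q (t + d) governs a_n. It sends
    q^n a_N + e / 2 below q^(n+1) a_N + e / 2 as soon as q (e / 2 + d) <= e / 2,
    which makes e / 2 an absorbing level. *)
Lemma contracting_recurrence_cvg0 (R : realType) (q : R) (a b : nat -> R) :
  0 <= q < 1 -> (forall n, 0 <= a n) ->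
  (forall n, a n.+1 <= q * (a n + b n)) ->
  (forall e, 0 < e -> \forall n \near \oo, b n < e) ->
  forall e, 0 < e -> \forall n \near \oo, a n < e.
Proof.
move=> /andP[q0 q1] a0 aS b_small e e0.
(* With d = (1 - q) e / 2, the absorption condition becomes
   q (2 - q) = 1 - (1 - q)^2 <= 1. *)
have d0 : 0 < (1 - q) * (e / 2) by rewrite mulr_gt0// ?subr_gt0// divr_gt0.
have [N _ bN] := b_small _ d0.
have aN n : a (n + N)%N <= q ^+ n * a N + e / 2.
  elim: n => [|n IH]; first by rewrite add0n expr0 mul1r lerDl; lra.
  have bn : b (n + N)%N < (1 - q) * (e / 2) by apply: bN; rewrite /= leq_addl.
  rewrite addSn exprS -mulrA; apply: le_trans (aS _) _.
  have : q * (a (n + N)%N + b (n + N)%N)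
      <= q * (q ^+ n * a N + e / 2 + (1 - q) * (e / 2)).
    by rewrite ler_wpM2l// lerD// ltW.
  by move/le_trans; apply; nra.
have := @cvg_geometric R (a N) q; rewrite ger0_norm// => /(_ q1) geo.
have e20 : 0 < e / 2 by rewrite divr_gt0.
have [M _ geoM] := @cvgr0_norm_lt _ R^o _ _ _ _ geo _ e20.
exists (M + N)%N => // n /= MNn.
have Nn : (N <= n)%N by apply: leq_trans MNn; rewrite leq_addl.
have := aN (n - N)%N; rewrite subnK// => /le_lt_trans; apply.
have Mn : (M <= n - N)%N by rewrite leq_subRL// addnC.
have := geoM (n - N)%N Mn; rewrite /geometric/= ger0_norm; last by rewrite mulr_ge0// exprn_ge0.
lra.
Qed.

(** Balls of the scalar field have radii in that field: in the complex case a
    real radius has to be embedded first, and the comparison of norms read off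
    on real parts. *)
Lemma near_absval (R : realType) (s : scalars) (k0 : (scalar_field R s)^o) (d : R) :
  0 < d -> \forall k \near k0, absval (k - k0 : scalar_field R s) < d.
Proof.
case: s k0 => k0 d0 /=.
  have := @nbhsx_ballx _ _ k0 d d0.
  by apply: filterS => k; rewrite -ball_normE/= distrC.
have dC : 0 < d%:C%C :> R[i] by rewrite ltcR.
have := @nbhsx_ballx _ _ k0 _ dC.
apply: filterS => k; rewrite -ball_normE/= distrC ltcE/= => /andP[_].
exact.
Qed.

Lemma absval0 (R : realType) (s : scalars) : absval (0 : scalar_field R s) = 0.
Proof.
case: s; first exact: (normr0 R).
exact: (congr1 (@complex.Re R) (normr0 R[i])).
Qed.

Lemma absval2 (R : realType) (s : scalars) : absval (2 : scalar_field R s) = 2.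
Proof.
case: s; first exact: (normr_nat R 2).
exact: (congr1 (@complex.Re R) (normr_nat R[i] 2)).
Qed.

Lemma absval_ge0 (R : realType) (s : scalars)  (k : scalar_field R s) : 0 <= absval k.
Proof.
case: s k => k //=.
have := normr_ge0 k.
by rewrite lecE => /andP[_].
Qed.

(** A sub-basic set around l need not be centred at l, but by subadditivity it
    contains the set centred at l with radius e - sigma (l - x); the condition
    sigma 0 = 0 makes the centred sets neighbourhoods of their centre. *)
Lemma cvg_seminorm_space (R : realType) (K : numFieldType) (V : lmodType K)
    (S : set (V -> R))
    (S0 : forall sigma, S sigma -> sigma 0 = 0)
    (SD : forall sigma, S sigma -> forall x y, sigma (x + y) <= sigma x + sigma y)
    (F : set_system (seminorm_space S)) (FF : Filter F) (l : seminorm_space S) :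
  F --> l <-> forall sigma, S sigma -> forall e, 0 < e ->
    \forall y \near F, sigma (y - l) < e.
Proof.
split=> [Fl sigma Ssigma e e0|Fl A].
  apply: Fl; exists [set y | sigma (y - l) < e]; split => //=.
    exists [set [set y | sigma (y - l) < e]]; last by rewrite bigcup_set1.
    move=> _ ->; apply: finI_from1.
    by exists l, sigma, e; split.
  by rewrite subrr S0.
rewrite nbhsE => -[_ [[B sB <-] [C BC Cl] CA]].
rewrite nbhs_filterE; apply: filterS CA _; apply: (@filterS _ _ _ C).
  by move=> y Cy; exists C.
have /sB [D sD DC] := BC; rewrite -DC; apply: filter_bigI => E DE.
have El : E l by move: Cl; rewrite -DC => /(_ _ DE).
have /sD := DE; rewrite inE => -[x [sigma [e [Ssigma e0 EE]]]].
move: El; rewrite /= EE /= => lx.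
have : 0 < e - sigma (l - x) by rewrite subr_gt0.
move=> /(Fl _ Ssigma); apply: filterS => y /= yl.
have := SD _ Ssigma (y - l) (l - x); rewrite addrA subrK.
by lra.
Qed.

(** Expanding around (k0, x0) leaves k only inside k - k0, so near (k0, x0) each
    term is a product of a bounded factor and a small one. *)
Lemma homogeneous_seminorm_scale_diff (R : realType) (s : scalars)
    (V : lmodType (scalar_field R s)) (p : R) (sigma : V -> R)
    (k k0 : scalar_field R s) (x x0 : V) :
  homogeneous_seminorm p sigma ->
  sigma (k *: x - k0 *: x0) <=
    absval k0 `^ p * sigma (x - x0) + absval (k - k0) `^ p * sigma (x - x0)
    + absval (k - k0) `^ p * sigma x0.
Proof.
move=> [_ sD sZ].
have -> : k *: x - k0 *: x0 =
    k0 *: (x - x0) + (k - k0) *: (x - x0) + (k - k0) *: x0.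
  by rewrite -scalerDl [k0 + _]addrC subrK scalerBr scalerBl addrA subrK.
by rewrite -!sZ (le_trans (sD _ _))// lerD2r sD.
Qed.

Section seminorm_space_theory.
Context (R : realType) (s : scalars) (V : lmodType (scalar_field R s))
  (S : set (V -> R)).
Context (HS : forall sigma, S sigma ->
  exists p : R, 0 < p <= 1 /\ homogeneous_seminorm p sigma).

Let cvg_seminorm (F : set_system (seminorm_space S)) (FF : Filter F)
    (l : seminorm_space S) :
  F --> l <-> forall sigma, S sigma -> forall e, 0 < e ->
    \forall y \near F, sigma (y - l) < e.
Proof.
apply: cvg_seminorm_space => sigma /HS[p [/andP[p0 _] [_ sD sZ]]] //.
by rewrite -(scale0r (0 : V)) sZ absval0 powR0 ?mul0r// gt_eqF.
Qed.

Lemma seminorm_space_add_continuous :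
  continuous (fun z : seminorm_space S * seminorm_space S => z.1 + z.2).
Proof.
move=> [x0 y0]; apply/cvg_seminorm => sigma Ss e e0.
have [p [_ [_ sD _]]] := HS _ Ss.
have e20 : 0 < e / 2 by rewrite divr_gt0.
have nx : \forall z \near (x0, y0), sigma (z.1 - x0) < e / 2.
  exact: ((cvg_seminorm _ _ _).1 (@cvg_fst _ _ (nbhs x0) (nbhs y0) _) _ Ss _ e20).
have ny : \forall z \near (x0, y0), sigma (z.2 - y0) < e / 2.
  exact: ((cvg_seminorm _ _ _).1 (@cvg_snd _ _ (nbhs x0) (nbhs y0) _) _ Ss _ e20).
move: nx ny; apply: filterS2 => -[x y] /= xe ye.
rewrite opprD addrACA (le_lt_trans (sD _ _))//.
by rewrite (splitr e) ltrD.
Qed.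

Lemma seminorm_space_scale_continuous :
  continuous (fun z : (scalar_field R s)^o * seminorm_space S => z.1 *: z.2).
Proof.
move=> [k0 x0]; apply/cvg_seminorm => sigma Ss e e0.
have [p [/andP[p0 _] sigmap]] := HS _ Ss.
have [s0 sD sZ] := sigmap.
(* If |k - k0|^p <= 1, the first two terms of the splitting are at most
   (|k0|^p + 1) sigma (x - x0), whence d; the third is kept below e / 2 by
   |k - k0|^p <= c, where sigma x0 + 1 avoids a division by zero. *)
pose d := e / 2 / (absval (k0 : scalar_field R s) `^ p + 1).
have d0 : 0 < d by rewrite !divr_gt0// ltr_wpDl// powR_ge0.
pose c := e / 2 / (sigma x0 + 1).
have c0 : 0 < c by rewrite !divr_gt0// ltr_wpDl.
pose r := Num.min 1 (c `^ p^-1).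
have r0 : 0 < r by rewrite lt_min ltr01 powR_gt0.
have nk : \forall z \near (k0, x0), absval (z.1 - k0 : scalar_field R s) < r.
  exact: (@cvg_fst _ _ (nbhs k0) (nbhs x0) _ _ (near_absval R s k0 r r0)).
have nx : \forall z \near (k0, x0), sigma (z.2 - x0) < d.
  exact: ((cvg_seminorm _ _ _).1 (@cvg_snd _ _ (nbhs k0) (nbhs x0) _) _ Ss _ d0).
move: nk nx; apply: filterS2 => -[k x] /= kr xd.
have := homogeneous_seminorm_scale_diff _ _ _ _ _ k k0 x x0 sigmap.
move=> /le_lt_trans; apply.
have rp : absval (k - k0 : scalar_field R s) `^ p <= r `^ p.
  by rewrite ge0_ler_powR ?nnegrE ?absval_ge0 ?ltW.
have r1 : r `^ p <= 1.
  have <- : 1 `^ p = 1 :> R by rewrite powR1.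
  by rewrite ge0_ler_powR ?nnegrE ?(ltW r0) ?(ltW p0)// ge_min lexx.
have rc : r `^ p <= c.
  rewrite -[leRHS]powRr1 ?(ltW c0)// -(mulVf (lt0r_neq0 p0)) powRrM.
  by rewrite ge0_ler_powR ?nnegrE ?(ltW r0) ?(ltW p0) ?powR_ge0// ge_min lexx orbT.
rewrite -mulrDl (splitr e) ltr_leD//.
  apply: (@le_lt_trans _ _ ((absval (k0 : scalar_field R s) `^ p + 1) * sigma (x - x0))).
    by rewrite ler_wpM2r// lerD2l (le_trans rp).
  by rewrite mulrC -ltr_pdivlMr// ltr_wpDl// powR_ge0.
apply: (@le_trans _ _ (c * (sigma x0 + 1))).
  by rewrite ler_pM ?powR_ge0 ?lerDl// (le_trans rp).
by rewrite divfK// gt_eqF// ltr_wpDl.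
Qed.

Lemma seminorm_space_good : good (seminorm_space S).
Proof.
move=> u [l ul]; exists l; apply/cvg_seminorm => sigma Ss.
have [p [/andP[p0 _] [s0 sD sZ]]] := HS _ Ss.
have twop : 1 < 2 `^ p :> R.
  have oneXp : 1 `^ p = 1 :> R by rewrite powR1.
  by rewrite -{1}oneXp gt0_ltr_powR ?nnegrE// ltr1n.
have twop0 : 0 < 2 `^ p :> R := lt_trans ltr01 twop.
apply: (@contracting_recurrence_cvg0 R (2 `^ p)^-1 _
  (fun n => sigma (2 *: u n.+1 - u n - l))) => //.
- by rewrite invr_ge0 ltW//= invf_lt1.
- move=> n; rewrite mulrC ler_pdivlMr// mulrC -(absval2 R s) -sZ.
  have -> : 2 *: (u n.+1 - l) = (u n - l) + (2 *: u n.+1 - u n - l) :> V.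
    by rewrite [RHS]addrC addrACA subrK -opprD scalerBr [2 *: l]scaler_nat.
  exact: sD.
- exact: ((cvg_seminorm _ _ _).1 ul _ Ss).
Qed.

End seminorm_space_theory.

Theorem proposition2p8 (R : realType) (s : scalars)
    (V : lmodType (scalar_field R s)) (S : set (V -> R))
    (HS : forall sigma, S sigma ->
      exists p : R, 0 < p <= 1 /\ homogeneous_seminorm p sigma) :
  topological_vector_space (seminorm_space S) /\ good (seminorm_space S).
Proof.
split; last exact: seminorm_space_good.
split; first exact: seminorm_space_add_continuous.
exact: seminorm_space_scale_continuous.
Qed.
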